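(* Let $(A,X)$ be a primitive axial algebra (for some fusion law $\mathcal{F}\subseteq\mathbb{F}$ over a field $\mathbb{F}$). Then the hull-kernel topology on the set $\mathcal{M}$ of all maximal ideals of $A$ is discrete.
   Context: Algebras are not assumed associative or unital. A fusion law is a set $\mathcal{F}\subseteq\mathbb{F}$ ($\mathbb{F}$ a field, always $1\in\mathcal{F}$) with a map $\ast:\mathcal{F}\times\mathcal{F}\to 2^{\mathcal{F}}$. For a commutative $\mathbb{F}$-algebra $A$, $a\in A$ and $\lambda\in\mathbb{F}$ let $A_\lambda(a)=\{u\in A\mid au=\lambda u\}$, and for $\Lambda\subseteq\mathbb{F}$ let $A_\Lambda(a)=\bigoplus_{\lambda\in\Lambda}A_\lambda(a)$. A non-zero idempotent $a\in A$ is an axis for $\mathcal{F}$ if $A=A_{\mathcal{F}}(a)$ and $A_\lambda(a)A_\mu(a)\subseteq A_{\lambda\ast\mu}(a)$ for all $\lambda,\mu\in\mathcal{F}$; it is primitive if $A_1(a)=\mathbb{F}a$. A primitive axial algebra for $\mathcal{F}$ is a pair $(A,X)$ with $A$ a commutative $\mathbb{F}$-algebra and $X\subseteq A$ a set of primitive axes for $\mathcal{F}$ generating $A$ as an algebra. Maximal ideals are maximal among proper ideals. The hull-kernel topology on $\mathcal{M}$ is given by the closure operation: for $\mathcal{S}\subseteq\mathcal{M}$, $\overline{\mathcal{S}}=\{J\in\mathcal{M}\mid J\supseteq K\}$, where $K=\bigcap_{I\in\mathcal{S}}I$ (with $K=A$ when $\mathcal{S}=\emptyset$). *)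

(* Defs.v *)
From HB Require Import structures.
From mathcomp Require Import all_boot all_order all_algebra.
From mathcomp Require Import all_classical.
From mathcomp Require Import topology.

Set Implicit Arguments.
Unset Strict Implicit.
Unset Printing Implicit Defensive.

Import GRing.Theory.
Local Open Scope classical_set_scope.
Local Open Scope ring_scope.

(* [fusion] is total on F; only its values on [fusion_set] matter. *)
Record fusion_law (F : fieldType) := FusionLaw {
  fusion_set :> set F;
  fusion_set1 : fusion_set 1;
  fusion : F -> F -> set F;
  fusion_sub : forall l m, fusion_set l -> fusion_set m ->
    fusion l m `<=` fusion_set }.

(* Products are [mul u v]: no associativity or unit is assumed. *)
Section Algebra.
Context (F : fieldType) (A : lmodType F) (mul : {bilinear A -> A -> A}).
Implicit Types (a : A) (l m : F) (S I J X : set A).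

Definition subspace S :=
  S 0 /\ forall l u v, S u -> S v -> S (l *: u + v).

Definition subalgebra S :=
  subspace S /\ forall u v, S u -> S v -> S (mul u v).

Definition generates X := smallest subalgebra X = setT.

Definition ideal I :=
  subspace I /\ forall u v, I v -> I (mul u v) /\ I (mul v u).

Definition proper_ideal I := ideal I /\ I <> setT.

Definition maximal_ideal I :=
  proper_ideal I /\ forall J, proper_ideal J -> I `<=` J -> J = I.

Definition eigenspace a l : set A := [set u | mul a u = l *: u].

(* The eigenspaces are independent, so their sum, the set of all finite sums
   of eigenvectors with eigenvalues in L, is automatically direct. *)
Definition eigensum a (L : set F) : set A :=
  [set u | exists (n : nat) (l : 'I_n -> F) (v : 'I_n -> A),
     (forall i, L (l i) /\ eigenspace a (l i) (v i)) /\ u = \sum_i v i].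

Definition axis (Fl : fusion_law F) a :=
  [/\ a <> 0, mul a a = a, eigensum a Fl = setT &
      forall l m, fusion_set Fl l -> fusion_set Fl m ->
        forall u v, eigenspace a l u -> eigenspace a m v ->
          eigensum a (fusion Fl l m) (mul u v)].

Definition primitive a := eigenspace a 1 = range (fun c : F => c *: a).

Definition primitive_axis (Fl : fusion_law F) a := axis Fl a /\ primitive a.

End Algebra.

Record primitive_axial_algebra (F : fieldType) (Fl : fusion_law F) :=
  PrimitiveAxialAlgebra {
    pax_sort :> lmodType F;
    pax_mul : {bilinear pax_sort -> pax_sort -> pax_sort};
    pax_mulC : commutative pax_mul;
    pax_axes : set pax_sort;
    pax_axesP : pax_axes `<=` primitive_axis pax_mul Fl;
    pax_gen : generates pax_mul pax_axes }.

Arguments pax_axes {F Fl} p _.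
Arguments pax_gen {F Fl} p.

Record max_ideal (F : fieldType) (Fl : fusion_law F)
    (A : primitive_axial_algebra Fl) := MaxIdeal {
  max_ideal_set :> set A;
  max_idealP : maximal_ideal (pax_mul A) max_ideal_set }.

HB.instance Definition _ F Fl A := gen_eqMixin (@max_ideal F Fl A).
HB.instance Definition _ F Fl A := gen_choiceMixin (@max_ideal F Fl A).

Section HullKernel.
Context (F : fieldType) (Fl : fusion_law F) (A : primitive_axial_algebra Fl).
Local Notation mul := (pax_mul A).
Local Notation M := (max_ideal A).
Implicit Types S T U : set M.

(* For S = set0 this is all of A. *)
Definition hk_kernel S : set A := \bigcap_(I in S) (I : set A).

Definition hk_closure S : set M := [set J : M | hk_kernel S `<=` J].

Definition hk_open U := hk_closure (~` U) = ~` U.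

Lemma sub_hk_closure S : S `<=` hk_closure S.
Proof. by move=> J SJ u; apply. Qed.

Lemma hk_closureS S T : S `<=` T -> hk_closure S `<=` hk_closure T.
Proof. by move=> ST J SJ u Tu; apply: SJ => I /ST; apply: Tu. Qed.

Lemma hk_closure_idem S : hk_closure (hk_closure S) = hk_closure S.
Proof.
apply/seteqP; split; last exact: sub_hk_closure.
by move=> J SJ u Su; apply: SJ => I; apply.
Qed.

Lemma hk_closure0 : hk_closure set0 = set0.
Proof.
rewrite -subset0 => J J0; case: (max_idealP J) => -[_ JT] _; apply: JT.
by rewrite -subTset => u _; apply: J0 => I.
Qed.

Lemma idealB (I : set A) u v : ideal mul I -> I u -> I v -> I (u + v).
Proof. by move=> [[_ Ilin] _] Iu Iv; have := Ilin 1 _ _ Iu Iv; rewrite scale1r. Qed.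

Lemma hk_kernel_ideal S : ideal mul (hk_kernel S).
Proof.
split; first split=> [I _|l u v Su Sv I SI].
- by case: (max_idealP I) => -[[[]]].
- by case: (max_idealP I) => -[[[_ Il] _] _] _; apply: Il; [exact: Su|exact: Sv].
by move=> u v Sv; split=> I SI; case: (max_idealP I) => -[[_ Im] _] _;
  case: (Im u v (Sv _ SI)).
Qed.

Lemma max_ideal_add_full (J : M) (K : set A) u :
  ideal mul K -> ~ (K `<=` J) ->
  exists k j, [/\ K k, max_ideal_set J j & u = k + j].
Proof.
move=> [[K0 Kl] Km] KJ.
pose P := [set x | exists k j, [/\ K k, max_ideal_set J j & x = k + j]].
have [[[[J0 Jl] Jm] _] Jmax] := max_idealP J.
suff PT : P = setT by have : P u by rewrite PT.
apply: contrapT => PT; apply: KJ.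
have <- : P = J.
  apply: Jmax => [|j Jj]; last by exists 0, j; rewrite add0r.
  split=> //; split; first split; first by exists 0, 0; rewrite addr0.
    move=> l _ _ [k [j [Kk Jj ->]]] [k' [j' [Kk' Jj' ->]]].
    exists (l *: k + k'), (l *: j + j'); split; [exact: Kl|exact: Jl|].
    by rewrite scalerDr addrACA.
  move=> v _ [k [j [Kk Jj ->]]]; have [? ?] := Km v _ Kk; have [? ?] := Jm v _ Jj.
  split; first by exists (mul v k), (mul v j); rewrite linearDr.
  by exists (mul k v), (mul j v); rewrite linearDl.
by move=> k Kk; exists k, 0; rewrite addr0.
Qed.

Lemma max_ideal_axis (J : M) : exists2 a, pax_axes A a & ~ max_ideal_set J a.
Proof.
have [[[Jsp Jm] JT] _] := max_idealP J.
apply: contrapT => nJ; apply: JT; rewrite -subTset -(pax_gen A).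
apply: smallest_sub; first by split=> // u v _ Jv; case: (Jm u v Jv).
by move=> a Xa; apply: contrapT => Ja; apply: nJ; exists a.
Qed.

(* Maximal ideals are prime: an axis outside J is idempotent, hence A A is not
   contained in J. *)
Lemma hk_closureU S T : hk_closure (S `|` T) = hk_closure S `|` hk_closure T.
Proof.
apply/seteqP; split=> [J STJ|J]; last first.
  by case; apply: hk_closureS => I SI; [left|right].
apply: contrapT => /not_orP[SJ TJ].
have [a Xa []] := max_ideal_axis J.
have [[_ aa _ _] _] := pax_axesP Xa.
have [k [j [Sk Jj ak]]] := max_ideal_add_full a (hk_kernel_ideal S) SJ.
have [k' [j' [Tk Jj' ak']]] := max_ideal_add_full a (hk_kernel_ideal T) TJ.
have [Jid _] := (max_idealP J).1; have [_ Jm] := Jid.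
rewrite -aa {2}ak' linearDr; apply: (idealB Jid); last by case: (Jm a j' Jj').
rewrite ak linearDl; apply: (idealB Jid); last by case: (Jm k' j Jj).
apply: STJ => I [SI|TI]; have [[[_ Im] _] _] := max_idealP I.
  by case: (Im k' k (Sk _ SI)).
by case: (Im k k' (Tk _ TI)).
Qed.

Lemma hk_openT : hk_open setT.
Proof. by rewrite /hk_open setCT hk_closure0. Qed.

Lemma hk_openI : setI_closed hk_open.
Proof. by move=> U V oU oV; rewrite /hk_open setCI hk_closureU oU oV. Qed.

Lemma hk_open_bigU (I : Type) (f : I -> set M) :
  (forall i, hk_open (f i)) -> hk_open (\bigcup_i f i).
Proof.
move=> of_; rewrite /hk_open setC_bigcup.
apply/seteqP; split; last exact: sub_hk_closure.
move=> J fJ i _; rewrite -of_; apply: hk_closureS fJ => L; exact.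
Qed.

HB.instance Definition _ :=
  isOpenTopological.Build M hk_openT hk_openI hk_open_bigU.

Lemma closure_hk_closure S : closure S = hk_closure S.
Proof.
rewrite closureE; apply/seteqP; split.
  apply: smallest_sub; last exact: sub_hk_closure.
  by rewrite -openC; change (hk_open (~` hk_closure S));
     rewrite /hk_open setCK hk_closure_idem.
move=> J SJ T [cT ST]; apply: (_ : hk_closure S `<=` T) => //.
move: cT; rewrite -openC; change (hk_open (~` T) -> hk_closure S `<=` T).
by rewrite /hk_open setCK => <-; apply: hk_closureS.
Qed.

End HullKernel.

(* Main.v *)
Require Import Defs.
From HB Require Import structures.
From mathcomp Require Import all_boot all_order all_algebra.
From mathcomp Require Import all_classical.
From mathcomp Require Import topology.

(** At most one maximal ideal misses a given primitive axis [a].  Let [I] and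
    [J] be distinct maximal ideals missing [a], and write [a = i + j].  A
    product [T] of operators [ad a - l], [l <> 1], kills every component of [i]
    except the one in [A_1(a) = F a]; hence [T i], lying in both [I] and [F a],
    is zero, and [T j = T a] is a non-zero multiple of [a] in [J], a
    contradiction.  Now every maximal ideal [J] misses some axis [a], which then
    lies in all other maximal ideals, so [J] is in the closure of no set of
    maximal ideals that omits it. *)

Set Implicit Arguments.
Unset Strict Implicit.
Unset Printing Implicit Defensive.

Import GRing.Theory.
Local Open Scope classical_set_scope.
Local Open Scope ring_scope.

Section ShiftedMultiplication.
Context (F : fieldType) (A : lmodType F) (mul : {bilinear A -> A -> A}).
Implicit Types (a u v : A) (l : F) (s : seq F) (I J : set A).

Definition shifted_mul a s u := foldr (fun l w => mul a w - l *: w) u s.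

Lemma shifted_mul_is_linear a s : linear (shifted_mul a s).
Proof.
move=> c u v; elim: s => //= l s ->.
rewrite linearDr linearZr_LR scalerBr !scalerDr !scalerA (mulrC l c).
by rewrite opprD addrACA.
Qed.

HB.instance Definition _ a s :=
  GRing.isLinear.Build F A A _ (shifted_mul a s) (shifted_mul_is_linear a s).

Lemma shifted_mul_eigen a s l v :
  Defs.eigenspace mul a l v -> shifted_mul a s v = (\prod_(m <- s) (l - m)) *: v.
Proof.
move=> av; elim: s => [|m s IHs] /=; first by rewrite big_nil scale1r.
by rewrite big_cons IHs linearZr_LR av !scalerA -scalerBl mulrBl (mulrC l).
Qed.

Lemma shifted_mul_ideal a s I u : ideal mul I -> I u -> I (shifted_mul a s u).
Proof.
move=> [[_ Il] Im] Iu; elim: s => //= l s Is.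
by rewrite addrC -scaleNr; apply: Il => //; case: (Im a _ Is).
Qed.

(** The list [s] collects the eigenvalues other than 1 in one decomposition of [u], so it depends on
    [u] and [L] may be infinite. Primitivity handles the components with eigenvalue 1. *)
Lemma shifted_mul_line (L : set F) a u :
  primitive mul a -> eigensum mul a L u ->
  exists2 s, 1 \notin s & exists c, shifted_mul a s u = c *: a.
Proof.
move=> prim [n [l [v [lv ->]]]].
pose s := [seq l i | i <- enum 'I_n & l i != 1].
exists s; first by apply/mapP => -[i]; rewrite mem_filter eq_sym => /andP[/eqP].
suff /choice[c cE] : forall i, exists c, shifted_mul a s (v i) = c *: a.
  by exists (\sum_i c i); rewrite linear_sum scaler_suml; apply: eq_bigr => i _; exact: cE.
move=> i; have [_ vi] := lv i; rewrite (shifted_mul_eigen s vi).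
have [l1|l1] := eqVneq (l i) 1.
  have : Defs.eigenspace mul a 1 (v i) by rewrite -l1.
  by rewrite prim => -[c _ <-]; eexists; rewrite scalerA.
exists 0; rewrite (big_rem (l i)) /= ?subrr ?mul0r ?scale0r//.
by apply: map_f; rewrite mem_filter l1 mem_enum.
Qed.

Lemma ideal_missing_axis_sum (Fl : fusion_law F) a I J i j :
  primitive_axis mul Fl a -> ideal mul I -> ideal mul J ->
  I i -> J j -> a = i + j -> I a \/ J a.
Proof.
move=> [[a0 aa AE _] prim] Iid Jid Ii Jj aE.
have multiple c K : ideal mul K -> c != 0 -> K (c *: a) -> K a.
  move=> [[K0 Kl] _] c0 Kc.
  by have := Kl c^-1 _ _ Kc K0; rewrite addr0 scalerA mulVf// scale1r.
have [s s1 [c Ts]] : exists2 s, 1 \notin s & exists c, shifted_mul a s i = c *: a.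
  by apply: (@shifted_mul_line Fl) => //; rewrite AE.
(* With [T = shifted_mul a s]: if [c] is non-zero, [T i] already puts [a] in [I]; otherwise
   [T j = T a]. *)
have [c0|c0] := eqVneq c 0; last first.
  by left; apply: (multiple c) => //; rewrite -Ts; exact: shifted_mul_ideal.
right; have a1 : Defs.eigenspace mul a 1 a by rewrite /Defs.eigenspace /= aa scale1r.
(* The eigenvalue of [T] on [a], non-zero because 1 is not in [s]. *)
apply: (multiple (\prod_(m <- s) (1 - m))) => //.
  by rewrite prodf_seq_neq0; apply/allP => m ms /=; rewrite subr_eq0;
     apply: contraNneq s1 => ->.
rewrite -(shifted_mul_eigen s a1) [X in shifted_mul a s X]aE linearD /= Ts c0.
by rewrite scale0r add0r; exact: shifted_mul_ideal.
Qed.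

End ShiftedMultiplication.

(** Proofs of maximality are irrelevant. *)
Lemma max_ideal_inj (F : fieldType) (Fl : fusion_law F)
    (A : primitive_axial_algebra Fl) : injective (@max_ideal_set F Fl A).
Proof.
move=> [I Imax] [J Jmax] /= IJ; case: _ / IJ in Jmax *.
by rewrite (Prop_irrelevance Imax Jmax).
Qed.

Lemma max_ideal_missing_axis_unique (F : fieldType) (Fl : fusion_law F)
    (A : primitive_axial_algebra Fl) (a : A) (I J : max_ideal A) :
  pax_axes A a -> ~ max_ideal_set I a -> ~ max_ideal_set J a -> I = J.
Proof.
move=> Xa Ia Ja; apply: max_ideal_inj.
have [[Iid _] Imax] := max_idealP I; have [Jprop _] := max_idealP J.
apply: contrapT => IJ.
(* Distinct maximal ideals are incomparable, so [I + J = A]. *)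
have nsub : ~ (max_ideal_set I `<=` J) by move=> /(Imax _ Jprop)/esym.
have [i [j [Ii Jj aE]]] := max_ideal_add_full a Iid nsub.
by case: (ideal_missing_axis_sum (pax_axesP Xa) Iid Jprop.1 Ii Jj aE).
Qed.

Theorem proposition8p4 (F : fieldType) (Fl : fusion_law F)
    (A : primitive_axial_algebra Fl) :
  forall U : set (max_ideal A), open U.
Proof.
move=> U; change (hk_open U); apply/seteqP; split; last exact: sub_hk_closure.
move=> J clJ UJ; have [a Xa Ja] := max_ideal_axis J.
(* Every [I] outside [U] contains [a]: otherwise [I] would be [J], which lies in [U]. *)
apply: (Ja); apply: clJ => I nUI; apply: contrapT => Ia; apply: nUI.
by rewrite (max_ideal_missing_axis_unique Xa Ia Ja).
Qed.
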